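(* For every integer $n\geq 3$, $b(G_{n,3})=1$ if $n\equiv 1$ or $2 \pmod 4$, and $b(G_{n,3})=2$ if $n\equiv 0$ or $3\pmod 4$.
   Context: All graphs are finite, simple and undirected. For positive integers $n,m$, the mesh $G_{n,m}=P_n\times P_m$ is the Cartesian product of paths on $n$ and $m$ vertices: its vertex set is $\{u_{i,j} : 1\leq i\leq n,\ 1\leq j\leq m\}$, and $u_{i,j}$ is adjacent to $u_{k,l}$ iff $|i-k|+|j-l|=1$. A nonempty set $D\subseteq V(G)$ is a dominating set of $G$ if every vertex of $G$ is in $D$ or adjacent to a vertex of $D$; the domination number $\gamma(G)$ is the minimum cardinality of a dominating set. For a graph $G$ with at least one edge, the bondage number is $b(G)=\min\{|B| : B\subseteq E(G),\ \gamma(G-B)>\gamma(G)\}$, where $G-B$ is obtained from $G$ by deleting the edges in $B$ (keeping all vertices). *)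

(* Defs.v *)
From mathcomp Require Import all_boot ssrint.

Set Implicit Arguments.
Unset Strict Implicit.
Unset Printing Implicit Defensive.

(* Finite simple undirected graphs. *)
Record sgraph := SGraph {
  vertex :> finType;
  adj : rel vertex;
  adj_sym : symmetric adj;
  adj_irrefl : irreflexive adj }.

(* An edge is the two-element set of its end points. *)
Definition edges (G : sgraph) : {set {set G}} :=
  [set [set p.1; p.2] | p : G * G & adj p.1 p.2].

Definition del_adj (G : sgraph) (B : {set {set G}}) : rel G :=
  fun x y => adj x y && ([set x; y] \notin B).

Lemma del_adj_sym (G : sgraph) (B : {set {set G}}) : symmetric (del_adj B).
Proof. by move=> x y; rewrite /del_adj adj_sym setUC. Qed.

Lemma del_adj_irrefl (G : sgraph) (B : {set {set G}}) : irreflexive (del_adj B).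
Proof. by move=> x; rewrite /del_adj adj_irrefl. Qed.

Definition del_edges (G : sgraph) (B : {set {set G}}) : sgraph :=
  SGraph (del_adj_sym B) (del_adj_irrefl B).

Definition dominating (G : sgraph) (D : {set G}) : bool :=
  (D != set0) && [forall x, (x \in D) || [exists y in D, adj x y]].

(* The starting point [set: G] is dominating as soon as G has a vertex; see
   [domination_numberP]. *)
Definition domination_number (G : sgraph) : nat :=
  #|[arg min_(D < [set: G] | dominating D) #|D|]|.

Definition bonding (G : sgraph) (B : {set {set G}}) : bool :=
  (B \subset edges G) &&
  (domination_number G < domination_number (del_edges B)).

(* The starting point [edges G] is bonding as soon as G has an edge; see
   [bondage_numberP]. *)
Definition bondage_number (G : sgraph) : nat :=
  #|[arg min_(B < edges G | bonding B) #|B|]|.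

Lemma domination_numberP (G : sgraph) : 0 < #|G| ->
  (exists2 D : {set G}, dominating D & #|D| = domination_number G) /\
  (forall D : {set G}, dominating D -> domination_number G <= #|D|).
Proof.
move=> G0; rewrite /domination_number; case: arg_minnP => [|D domD minD].
  rewrite /dominating -card_gt0 cardsT G0 /=.
  by apply/forallP=> x; rewrite inE.
by split; [exists D | exact: minD].
Qed.

Lemma bonding_edges (G : sgraph) : edges G != set0 -> bonding (edges G).
Proof.
case/set0Pn=> _ /imsetP[[x y] /[!inE] /= xy _]; rewrite /bonding subxx /=.
have G0 : 0 < #|G| by apply/card_gt0P; exists x.
have nyx : y != x by apply: contraTneq xy => ->; rewrite adj_irrefl.
have [_ minG] := domination_numberP G0.
have [[D /andP[_ /forallP domD] <-] _] :=
  @domination_numberP (del_edges (edges G)) G0.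
have -> : D = [set: G].
  apply/setP=> z; rewrite inE; case/orP: (domD z) => // /existsP[t].
  case/andP=> _ /andP[zt /negP[]].
  by apply/imsetP; exists (z, t); rewrite ?inE.
apply: leq_ltn_trans (_ : #|[set: G] :\ x| < _); last first.
  by rewrite [in ltnRHS](cardsD1 x) inE.
apply: minG; apply/andP; split.
  by apply/set0Pn; exists y; rewrite !inE nyx.
apply/forallP=> z; rewrite !inE andbT; have [->|//] := eqVneq z x.
by apply/existsP; exists y; rewrite !inE nyx.
Qed.

Lemma bondage_numberP (G : sgraph) : edges G != set0 ->
  (exists2 B : {set {set G}}, bonding B & #|B| = bondage_number G) /\
  (forall B : {set {set G}}, bonding B -> bondage_number G <= #|B|).
Proof.
move=> EG; rewrite /bondage_number.
case: arg_minnP => [|B bondB minB]; first exact: bonding_edges.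
by split; [exists B | exact: minB].
Qed.

(* The pair (i, j) of zero-based indices stands for the vertex u_{i+1,j+1}. *)
Definition mesh_adj (n m : nat) : rel ('I_n * 'I_m) :=
  fun u v => `|u.1 - v.1| + `|u.2 - v.2| == 1.

Lemma mesh_adj_sym (n m : nat) : symmetric (@mesh_adj n m).
Proof. by move=> u v; rewrite /mesh_adj distnC [X in _ + X]distnC. Qed.

Lemma mesh_adj_irrefl (n m : nat) : irreflexive (@mesh_adj n m).
Proof. by move=> u; rewrite /mesh_adj !distnn. Qed.

Definition mesh (n m : nat) : sgraph :=
  SGraph (@mesh_adj_sym n m) (@mesh_adj_irrefl n m).

(* Main.v *)
Require Import Defs.
From mathcomp Require Import all_boot.
From mathcomp Require Import zify.

Set Implicit Arguments.
Unset Strict Implicit.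
Unset Printing Implicit Defensive.

(** A three-row mesh is read column by column.  The edges deleted to raise the
    domination number are those at a corner: their effect on the lower bound is
    confined to the first columns.

    Lower bounds.  A column of a dominating set leaves some of its vertices
    undominated by the columns up to it; these have to be met by the next
    column.  Attach to two consecutive columns the number [reserve], which
    measures how much more than 3/4 of a vertex per column the rest of the set
    must cost.  Passing to the next column lowers the reserve by at most
    4 * (its number of vertices) - 3 ([reserve_step]).  These inequalities
    telescope along the mesh, and [weight_bound] gives
    4 * |D| >= 3 * n + g where the gain g depends on the first three columns only.
    There g = 1 for the intact mesh, g = 3 when the corner edge inside
    the first column is deleted, and g = 5 when the corner is isolated by
    deleting both its edges.

    Upper bounds.  The middle vertex in every column i = 0 mod 4 and the two
    outer ones in every column i = 2 mod 4 form, with the last middle vertex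
    added when n is even, a dominating set of 3 * n / 4 + 1 vertices (rounded
    down).  Hence the domination number is that integer; deleting that one
    corner edge raises it when n = 1, 2 mod 4, and isolating the corner raises it
    for every n >= 3.

    If n = 0, 3 mod 4, exchanging the residues 0 and 2 gives a second dominating
    set of the same size.  The edges that the first pattern cannot do without
    and those that the second cannot do without are disjoint
    ([helper_disjoint]).  Whichever edge is deleted, one of the two patterns is
    therefore still dominating, and a single deletion never suffices. *)

(** * A potential on pairs of consecutive columns *)

(** Membership of the top, middle and bottom vertex. *)
Definition column : Type := bool * bool * bool.

Definition weight (c : column) : nat := let: (t, m, b) := c in t + m + b.

(** The vertices of column [c] that neither [c] nor the previous column [p]
    dominates. *)
Definition due (p c : column) : column :=
  let: (tp, mp, bp) := p in let: (t, m, b) := c in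
  (~~ [|| t, m | tp], ~~ [|| m, t, b | mp], ~~ [|| b, m | bp]).

Definition covers (q u : column) : bool :=
  let: (tq, mq, bq) := q in let: (t, m, b) := u in
  [&& t ==> tq, m ==> mq & b ==> bq].

Definition no_col : column := (false, false, false).

(** Three plus the least value of 4 * (vertices) - 3 * (columns) over all ways to
    continue the mesh beyond [c] so that everything in [c] and further on is
    dominated; in other words, a shortest distance in the graph of pairs of
    columns.  The offset three keeps it a natural number. *)
Definition reserve (p c : column) : nat :=
  let: (x, y, z) := due p c in let: (t, m, b) := c in
  if weight c == 0 then nth 0 (if y then [:: 4; 7; 9] else [:: 3; 5; 6]) (x + z)
  else x + z + 4 - (weight c + (t && b)).

(** The triangle inequality of a shortest distance, checked on all the triples
    of columns. *)
Lemma reserve_step p c q : covers q (due p c) ->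
  reserve p c + 3 <= 4 * weight q + reserve c q.
Proof.
by case: p c q => [[[] []] []] [[[] []] []] [[[] []] []].
Qed.

Lemma reserve_end p c : covers no_col (due p c) -> reserve p c <= 3.
Proof. by case: p c => [[[] []] []] [[[] []] []]. Qed.

(** In the three lemmas on initial columns the bound is 12 + g, where g is the
    gain over 3 * n in the bound on four times the size: nine for the three
    columns and three for the offset of [reserve].  Three columns are needed for
    the second one, since on two columns its gain would only be two. *)
Lemma reserve_start c0 c1 c2 :
  covers c1 (due no_col c0) -> covers c2 (due c0 c1) ->
  13 <= 4 * (weight c0 + weight c1 + weight c2) + reserve c1 c2.
Proof. by case: c0 c1 c2 => [[[] []] []] [[[] []] []] [[[] []] []]. Qed.

(** The edge between the top and the middle vertex of column 0 is missing, so
    these two do not dominate each other. *)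
Lemma reserve_start_cut1 t0 m0 b0 c1 c2 (c0 := (t0, m0, b0)) :
  t0 || c1.1.1 -> [|| m0, b0 | c1.1.2] -> [|| b0, m0 | c1.2] ->
  covers c2 (due c0 c1) ->
  15 <= 4 * (weight c0 + weight c1 + weight c2) + reserve c1 c2.
Proof.
by rewrite {}/c0; case: t0 m0 b0 c1 c2 => [] [] [] [[[] []] []] [[[] []] []].
Qed.

(** The top vertex of column 0 is isolated: it is in the set and dominates no
    other vertex, hence it counts as absent in what column 1 sees. *)
Lemma reserve_start_cut2 m0 b0 c1 c2 (c0 := (true, m0, b0)) :
  [|| m0, b0 | c1.1.2] -> [|| b0, m0 | c1.2] ->
  covers c2 (due (false, m0, b0) c1) ->
  17 <= 4 * (weight c0 + weight c1 + weight c2) + reserve c1 c2.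
Proof.
by rewrite {}/c0; case: m0 b0 c1 c2 => [] [] [[[] []] []] [[[] []] []].
Qed.

(** The empty column [c n] turns the domination of the last column into an
    instance of the same condition as for the others. *)
Lemma weight_bound (c : nat -> column) n g :
  3 <= n -> c n = no_col ->
  (forall i, 2 <= i < n -> covers (c i.+1) (due (c i.-1) (c i))) ->
  12 + g <= 4 * (weight (c 0) + weight (c 1) + weight (c 2))
            + reserve (c 1) (c 2) ->
  3 * n + g <= 4 * \sum_(0 <= i < n) weight (c i).
Proof.
move=> n3 cn covc start.
have tail k : 3 <= k <= n ->
    3 * k + 3 + g <= 4 * \sum_(0 <= i < k) weight (c i)
                     + reserve (c k.-2) (c k.-1).
  elim: k => // k IHk /andP[k3 kn]; have [k2|k2] := leqP k 2.
    (* The telescoping starts here, at a prefix of three columns. *)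
    have -> : k = 2 by lia.
    by rewrite !big_nat_recr //= big_geq //; lia.
  have {}IHk := IHk (introT andP (conj k2 (ltnW kn))).
  rewrite big_nat_recr //=.
  have := @reserve_step (c k.-2) (c k.-1) (c k).
  have := covc k.-1; rewrite (_ : k.-1.+1 = k); last by lia.
  move=> cov /(_ (cov _)); lia.
have := @reserve_end (c n.-2) (c n.-1).
have := covc n.-1; rewrite (_ : n.-1.+1 = n); last by lia.
rewrite cn => cov /(_ (cov _)); have := tail n; lia.
Qed.

(** * Two periodic dominating sets *)

(** For a shift [s] equal to 0 or 2: middle vertices in the columns congruent to
    [s] modulo 4 and outer ones two columns away. *)
Definition pattern n s i j : bool :=
  if j == 1 then ((i + s) %% 4 == 0) || ~~ odd n && (i == n.-1)
  else (i + s) %% 4 == 2.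

(** For the other residues of [n] the pattern of shift 2 has one vertex too many
    to be a minimum dominating set. *)
Definition fits n s : bool :=
  (s == 0) || (s == 2) && ((n %% 4 == 0) || (n %% 4 == 3)).

(** A vertex outside the pattern to which one dominator will be assigned.  The
    middle vertices between two outer members are excluded: they have two
    dominators, so a single deletion cannot harm them. *)
Definition lonely n s i j : bool :=
  ~~ pattern n s i j && ((i + s) %% 4 != 2).

(** The member of the pattern that dominates the lonely vertex (i, j).  The last
    case is the outer vertices of the last column when the next outer members
    would lie beyond it; the added middle vertex then takes over. *)
Definition helper n s i j : nat * nat :=
  if (i + s) %% 4 == 0 then (i, 1)
  else if j == 1 then (if (i + s) %% 4 == 1 then i.-1 else i.+1, 1)
  else if (i + s) %% 4 == 3 then (i.-1, j)
  else if i.+1 < n then (i.+1, j) else (i, 1).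

Lemma helper_pattern n s i j (q := helper n s i j) :
  fits n s ->
  i < n -> j < 3 -> lonely n s i j ->
  [/\ q.1 < n, q.2 < 3, pattern n s q.1 q.2 &
      ((j == q.2) && ((i.+1 == q.1) || (q.1.+1 == i)))
         || ((i == q.1) && ((j.+1 == q.2) || (q.2.+1 == j)))].
Proof.
rewrite {}/q /fits /lonely /helper /pattern => hs hi hj hp.
do ![case: ifP hp => /= ? hp] => //; split; lia.
Qed.

(** The two alternatives are the two ways in which the undirected edge from (i, j)
    to its dominator may equal the edge from (k, l) to its dominator. *)
Lemma helper_disjoint n i j k l (p := helper n 0 i j) (q := helper n 2 k l) :
  i < n -> j < 3 -> k < n -> l < 3 ->
  (n %% 4 == 0) || (n %% 4 == 3) ->
  lonely n 0 i j -> lonely n 2 k l ->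
  ~ ((i, j) = (k, l) /\ p = q) /\ ~ ((i, j) = q /\ p = (k, l)).
Proof.
rewrite {}/q {}/p => hi hj hk hl hn hp hq; split.
  move=> [[ek el]]; subst k l; move: hp hq; rewrite /lonely /helper /pattern.
  do ![case: ifP => /= ?] => // ? ? /eqP; rewrite xpair_eqE /=; lia.
case=> /eqP e1 /eqP e2; move: hp hq e1 e2; rewrite /lonely /helper /pattern.
do ![case: ifP => /= ?] => // ? ?; rewrite !xpair_eqE /=; lia.
Qed.

(** The quotients count the columns below [n] congruent to [s] and to [s + 2]
    modulo 4; the middle vertex added for even [n] is left out. *)
Lemma pattern_card n s : (s == 0) || (s == 2) ->
  \sum_(0 <= i < n)
    (((i + s) %% 4 == 2) + ((i + s) %% 4 == 0) + ((i + s) %% 4 == 2))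
  = (n + 3 - s) %/ 4 + 2 * ((n + 1 + s) %/ 4).
Proof.
move=> hs; elim: n => [|n IHn]; first by rewrite big_geq //; lia.
rewrite big_nat_recr //= IHn; lia.
Qed.

(** * Columns of a set of vertices of the mesh *)

Lemma set2_inj (T : finType) (a b c d : T) : [set a; b] = [set c; d] ->
  a = c /\ b = d \/ a = d /\ b = c.
Proof.
move=> /setP E.
have := E a; have := E b; have := E c; have := E d; rewrite !inE !eqxx ?orbT /=.
do ![case: eqP => //=]; move=> *; subst; auto.
Qed.

Section Mesh.

Variable n' : nat.
Let n := n'.+1.
Implicit Types (D : {set mesh n 3}) (B : {set {set mesh n 3}}).

Definition vtx (i j : nat) : mesh n 3 := (inord i, inord j).

(** False outside the mesh, so that neighbours may be named without regard to
    the border. *)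
Definition occ D (i j : nat) : bool :=
  [&& i < n, j < 3 & vtx i j \in D].

Definition edge i j k l : {set mesh n 3} := [set vtx i j; vtx k l].

Definition col D i : column := (occ D i 0, occ D i 1, occ D i 2).

Lemma vtx_val (u : mesh n 3) : vtx u.1 u.2 = u.
Proof. by case: u => i j; rewrite /vtx !inord_val. Qed.

Lemma occ_val D (u : mesh n 3) : occ D u.1 u.2 = (u \in D).
Proof. by rewrite /occ vtx_val !ltn_ord. Qed.

Lemma occ_row3 D i : occ D i 3 = false.
Proof. by rewrite /occ andbF. Qed.

Lemma card_col D : #|D| = \sum_(0 <= i < n) weight (col D i).
Proof.
rewrite -sum1_card big_mkcond.
rewrite (eq_bigr (fun u : 'I_n * 'I_3 => occ D u.1 u.2 : nat)); last first.
  by move=> u _; rewrite occ_val; case: (u \in D).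
rewrite -(pair_bigA _ (fun (i : 'I_n) (j : 'I_3) => occ D i j : nat)) /= big_mkord.
by apply: eq_bigr => i _; rewrite !big_ord_recl big_ord0 /= addn0 addnA.
Qed.

Lemma mesh_adjE (u v : mesh n 3) :
  adj u v = ((u.2 == v.2) && ((u.1.+1 == v.1) || (v.1.+1 == u.1)))
         || ((u.1 == v.1) && ((u.2.+1 == v.2) || (v.2.+1 == u.2))).
Proof.
case: u v => [[i Hi] [j Hj]] [[k Hk] [l Hl]] /=.
rewrite /mesh_adj -!val_eqE /=; lia.
Qed.

(** At the border a predecessor [i.-1] or [j.-1] is the vertex itself, which adds
    nothing to the disjunction, and a successor is never occupied. *)
Lemma dominating_del_edgesP B D i j :
  dominating (G := del_edges B) D -> i < n -> j < 3 ->
  occ D i j || has (fun q => occ D q.1 q.2 && (edge i j q.1 q.2 \notin B))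
                 [:: (i.-1, j); (i.+1, j); (i, j.-1); (i, j.+1)].
Proof.
move=> /andP[_ /forallP /(_ (vtx i j))] dom iltn jlt3.
rewrite {1}/occ iltn jlt3 /=.
case/orP: dom => [->//|/existsP[v /andP[vD /andP[]]]].
rewrite mesh_adjE -!val_eqE /= !inordK // => nb vB; apply/orP; right.
rewrite -occ_val in vD; rewrite -[v]vtx_val -/(edge _ _ _ _) in vB.
have hit k l : v.1 = k :> nat -> v.2 = l :> nat ->
  occ D k l && (edge i j k l \notin B) by move=> <- <-; rewrite vD.
case/orP: nb => /andP[/eqP e1 /orP[]/eqP e2].
- by rewrite (hit i.+1 j) ?orbT.
- by rewrite (hit i.-1 j) // -e2.
- by rewrite (hit i j.+1) ?orbT.
- by rewrite (hit i j.-1) ?orbT // -e2.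
Qed.

(** Vertices away from the deleted edges need no more than this weakening. *)
Lemma near_dominated B D i j :
  dominating (G := del_edges B) D -> i < n -> j < 3 ->
  [|| occ D i j, occ D i.-1 j, occ D i.+1 j, occ D i j.-1 | occ D i j.+1].
Proof.
move=> dom iltn jlt3; have := dominating_del_edgesP dom iltn jlt3; rewrite /=.
rewrite orbF; case/orP=> [->//|].
by case/or4P=> /andP[-> _]; rewrite ?orbT.
Qed.

Lemma covers_col B D i : dominating (G := del_edges B) D -> 0 < i < n ->
  covers (col D i.+1) (due (col D i.-1) (col D i)).
Proof.
move=> dom /andP[i0 iltn].
have := near_dominated dom iltn (isT : 0 < 3).
have := near_dominated dom iltn (isT : 1 < 3).
have := near_dominated dom iltn (isT : 2 < 3).
rewrite /col /=; rewrite occ_row3.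
by do ![case: (occ _ _ _) => //=].
Qed.

Lemma col_end D : col D n = no_col.
Proof. by rewrite /col /occ ltnn. Qed.

(** * Lower bounds on the size of a dominating set *)

Lemma dominating_card_ge B D g : 3 <= n -> dominating (G := del_edges B) D ->
  12 + g <= 4 * (weight (col D 0) + weight (col D 1) + weight (col D 2))
            + reserve (col D 1) (col D 2) ->
  3 * n + g <= 4 * #|D|.
Proof.
move=> n3 dom start; rewrite card_col.
apply: weight_bound; rewrite ?col_end //.
by move=> i hi; apply: covers_col dom _; lia.
Qed.

Lemma intact_card_ge D : 3 <= n -> dominating (G := del_edges set0) D ->
  3 * n + 1 <= 4 * #|D|.
Proof.
move=> n3 dom; apply: (dominating_card_ge n3 dom).
apply: reserve_start; last by apply: (covers_col dom); lia.
have n0 : 0 < n by [].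
have := near_dominated dom n0 (isT : 0 < 3).
have := near_dominated dom n0 (isT : 1 < 3).
have := near_dominated dom n0 (isT : 2 < 3).
rewrite /col /= occ_row3.
by do ![case: (occ _ _ _) => //=].
Qed.

Definition corner_edge : {set {set mesh n 3}} := [set edge 0 0 0 1].

Definition corner_edges : {set {set mesh n 3}} :=
  [set edge 0 0 0 1; edge 0 0 1 0].

Lemma corner_edge_card_ge D : 3 <= n ->
  dominating (G := del_edges corner_edge) D -> 3 * n + 3 <= 4 * #|D|.
Proof.
move=> n3 dom; apply: (dominating_card_ge n3 dom).
have n0 : 0 < n by [].
have := near_dominated dom n0 (isT : 2 < 3).
have := dominating_del_edgesP dom n0 (isT : 0 < 3).
have := dominating_del_edgesP dom n0 (isT : 1 < 3).
rewrite /= !inE /edge [[set vtx 0 1; vtx 0 0]]setUC eqxx /= !andbF occ_row3.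
move=> h1 h0 h2.
apply: reserve_start_cut1; last by apply: (covers_col dom); lia.
all: by move: h0 h1 h2; rewrite /=; do ![case: (occ _ _ _) => //=].
Qed.

Lemma corner_edges_card_ge D : 3 <= n ->
  dominating (G := del_edges corner_edges) D -> 3 * n + 5 <= 4 * #|D|.
Proof.
move=> n3 dom; apply: (dominating_card_ge n3 dom).
have n0 : 0 < n by [].
have n1 : 1 < n by lia.
have := near_dominated dom n0 (isT : 2 < 3).
have := dominating_del_edgesP dom n0 (isT : 0 < 3).
have := dominating_del_edgesP dom n0 (isT : 1 < 3).
have := dominating_del_edgesP dom n1 (isT : 0 < 3).
have := near_dominated dom n1 (isT : 1 < 3).
have := near_dominated dom n1 (isT : 2 < 3).
rewrite /= !inE /edge [[set vtx 0 1; vtx 0 0]]setUC [[set vtx 1 0; vtx 0 0]]setUC.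
rewrite !eqxx ?orbT /= !andbF /= !occ_row3.
move=> h12 h11 h10 h01 h00 h02.
have t0 : occ D 0 0 by move: h00; do ![case: (occ _ _ _) => //=].
rewrite /col t0; apply: reserve_start_cut2.
- by move: h01; rewrite /=; do ![case: (occ _ _ _) => //=].
- by move: h02; rewrite /=; do ![case: (occ _ _ _) => //=].
by move: h12 h11 h10; rewrite /=; do ![case: (occ _ _ _) => //=].
Qed.

(** * The patterns as sets of vertices *)

Lemma dominating_del_edgesI B D :
  (forall i j, i < n -> j < 3 -> vtx i j \notin D ->
     exists q, [/\ vtx q.1 q.2 \in D, adj (vtx i j) (vtx q.1 q.2)
                 & edge i j q.1 q.2 \notin B]) ->
  dominating (G := del_edges B) D.
Proof.
move=> H; apply/andP; split.
  apply/set0Pn; have [u0D|/(H 0 0 isT isT) [q [qD _ _]]] := boolP (vtx 0 0 \in D).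
    by exists (vtx 0 0).
  by exists (vtx q.1 q.2).
apply/forallP => u; apply/orP; have [uD|uD] := boolP (u \in D); [by left|right].
rewrite -(vtx_val u) in uD.
have [q [qD adjq qB]] := H _ _ (ltn_ord u.1) (ltn_ord u.2) uD.
by apply/existsP; exists (vtx q.1 q.2); rewrite qD /= /del_adj -{1 2}(vtx_val u) adjq.
Qed.

Definition pattern_set s : {set mesh n 3} :=
  [set u : mesh n 3 | pattern n s u.1 u.2].

Lemma in_pattern_set s i j : i < n -> j < 3 ->
  (vtx i j \in pattern_set s) = pattern n s i j.
Proof. by move=> hi hj; rewrite inE /= !inordK. Qed.

Lemma adj_vtx i j k l : i < n -> j < 3 -> k < n -> l < 3 ->
  adj (vtx i j) (vtx k l) =
  ((j == l) && ((i.+1 == k) || (k.+1 == i)))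
         || ((i == k) && ((j.+1 == l) || (l.+1 == j))).
Proof. by move=> *; rewrite mesh_adjE -!val_eqE /= !inordK. Qed.

Lemma vtx_inj i j k l : i < n -> j < 3 -> k < n -> l < 3 ->
  vtx i j = vtx k l -> (i, j) = (k, l).
Proof.
move=> hi hj hk hl [/(congr1 val) /= + /(congr1 val) /=].
by rewrite !inordK // => -> ->.
Qed.

(** When at most one edge is deleted, the edges from lonely vertices to their
    dominators are the only ones that the pattern cannot spare. *)
Lemma pattern_set_dominating s B :
  fits n s ->
  #|B| <= 1 ->
  (forall i j (q := helper n s i j), i < n -> j < 3 -> lonely n s i j ->
     edge i j q.1 q.2 \notin B) ->
  dominating (G := del_edges B) (pattern_set s).
Proof.
move=> hs B1 H; apply: dominating_del_edgesI => i j hi hj.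
rewrite in_pattern_set // => hp.
have [hl|] := boolP (lonely n s i j).
  exists (helper n s i j); have [h1 h2 h3 h4] := helper_pattern hs hi hj hl.
  by rewrite in_pattern_set // adj_vtx //; split=> //; apply: H.
rewrite /lonely hp andTb negbK => r2.
have j1 : j = 1 by move: hp; rewrite /pattern; case: ifP; lia.
rewrite {}j1 in hj hp *.
(* (i, j) is a middle vertex whose two outer neighbours both belong to the
   pattern, and at most one of these two edges is deleted. *)
have [e0|e0] := boolP (edge i 1 i 0 \in B); last first.
  exists (i, 0); split=> //; first by rewrite in_pattern_set // /pattern r2.
  by rewrite adj_vtx // !eqxx orbT.
exists (i, 2); split; first by rewrite in_pattern_set // /pattern r2.
  by rewrite adj_vtx // !eqxx orbT.
apply/negP => e2.
have /set2_inj[[_]|[]] := card_le1_eqP B1 _ _ e0 e2.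
  by move/vtx_inj => /(_ hi isT hi isT).
by move/vtx_inj => /(_ hi isT hi isT).
Qed.

Lemma pattern_set_card s :
  fits n s ->
  #|pattern_set s| <= 3 * n %/ 4 + 1.
Proof.
move=> hs; rewrite card_col.
have hs' : (s == 0) || (s == 2) by move: hs; rewrite /fits; lia.
apply: (@leq_trans (\sum_(0 <= i < n)
  ((((i + s) %% 4 == 2) + ((i + s) %% 4 == 0) + ((i + s) %% 4 == 2))
   + (~~ odd n && (i == n.-1))))).
  rewrite !big_nat; apply: leq_sum => i /andP[_ hi].
  rewrite /col /weight /occ hi /= !in_pattern_set // /pattern /=; lia.
rewrite big_split /= pattern_card //.
have -> : \sum_(0 <= i < n) (~~ odd n && (i == n.-1)) = ~~ odd n.
  rewrite big_nat_recr //= eqxx andbT big_nat big1 // => i /andP[_ hi].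
  by rewrite (ltn_eqF hi) andbF.
by move: hs; rewrite /fits; lia.
Qed.

(** * Domination numbers and bondage numbers *)

Lemma mesh_gt0 B : 0 < #|del_edges B|.
Proof. by apply/card_gt0P; exists (vtx 0 0). Qed.

(** If the deleted edge spoils the first pattern then it joins a lonely vertex of
    that pattern to its dominator, and by [helper_disjoint] it does not play that
    part in the second. *)
Lemma domination_number_del_edges_le B :
  #|B| <= 1 -> (B == set0) || (n %% 4 == 0) || (n %% 4 == 3) ->
  domination_number (del_edges B) <= 3 * n %/ 4 + 1.
Proof.
move=> B1 hB.
have [_ minD] := domination_numberP (mesh_gt0 B).
suff [s hs dom] : exists2 s, fits n s &
    dominating (G := del_edges B) (pattern_set s).
  exact: leq_trans (minD _ dom) (pattern_set_card hs).
have [/existsP[u /andP[ul uB]]|noedge] := boolP [exists u : mesh n 3,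
    lonely n 0 u.1 u.2 &&
    (edge u.1 u.2 (helper n 0 u.1 u.2).1 (helper n 0 u.1 u.2).2 \in B)].
  have hn : (n %% 4 == 0) || (n %% 4 == 3).
    by move: hB uB; case: eqP => // ->; rewrite inE.
  exists 2; first by rewrite /fits hn.
  apply: pattern_set_dominating => // k l q hk hl lon; apply/negP => vB.
  have [q1 q2 _ _] := helper_pattern (s := 2) hn hk hl lon.
  have [p1 p2 _ _] := helper_pattern (s := 0) isT (ltn_ord u.1) (ltn_ord u.2) ul.
  have [d1 d2] := helper_disjoint (ltn_ord u.1) (ltn_ord u.2) hk hl hn ul lon.
  have pairK (p : nat * nat) : (p.1, p.2) = p by case: p.
  have /set2_inj[[/vtx_inj e1 /vtx_inj e2]|[/vtx_inj e1 /vtx_inj e2]] :=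
    card_le1_eqP B1 _ _ vB uB.
    by apply: d1; split; [apply: e1|rewrite -[LHS]pairK -[RHS]pairK; apply: e2].
  by apply: d2; split; [rewrite -[RHS]pairK; apply: e1
                       |rewrite -[LHS]pairK; apply: e2].
exists 0 => //; apply: pattern_set_dominating => // i j q hi hj lon.
move: noedge; rewrite negb_exists => /forallP /(_ (vtx i j)) /=.
by rewrite !inordK // lon.
Qed.

Lemma domination_number_mesh_ge : 3 <= n -> 3 * n %/ 4 + 1 <= domination_number (mesh n 3).
Proof.
move=> n3; have [[D domD <-] _] := domination_numberP (G := mesh n 3) (mesh_gt0 set0).
suff /(intact_card_ge n3) : dominating (G := del_edges set0) D by lia.
apply: dominating_del_edgesI => i j hi hj nD.
case/andP: domD => _ /forallP /(_ (vtx i j)); rewrite (negPf nD) /=.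
case/existsP => v /andP[vD adjv]; exists (val v.1, val v.2).
by rewrite /= vtx_val inE.
Qed.

Lemma domination_number_del_edges B :
  domination_number (mesh n 3) <= domination_number (del_edges B).
Proof.
have [[D /andP[D0 domD] <-] _] := domination_numberP (mesh_gt0 B).
have [_ minD] := domination_numberP (G := mesh n 3) (mesh_gt0 B).
apply/minD/andP; split=> //; apply/forallP => u.
have /orP[->//|/existsP[v /and3P[vD uv _]]] := forallP domD u.
by apply/orP; right; apply/existsP; exists v; rewrite vD.
Qed.

Lemma domination_number_mesh_le : domination_number (mesh n 3) <= 3 * n %/ 4 + 1.
Proof.
apply: leq_trans (domination_number_del_edges set0) _.
by apply: domination_number_del_edges_le; rewrite ?cards0 ?eqxx.
Qed.

Lemma edge_in_edges i j k l : i < n -> j < 3 -> k < n -> l < 3 ->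
  adj (vtx i j) (vtx k l) -> edge i j k l \in edges (mesh n 3).
Proof.
by move=> hi hj hk hl a; apply/imsetP; exists (vtx i j, vtx k l); rewrite ?inE.
Qed.

Lemma not_bonding B : 3 <= n ->
  #|B| <= 1 -> (B == set0) || (n %% 4 == 0) || (n %% 4 == 3) -> ~~ bonding B.
Proof.
move=> n3 B1 hB; rewrite /bonding negb_and -leqNgt.
by rewrite (leq_trans (domination_number_del_edges_le B1 hB) (domination_number_mesh_ge n3)) orbT.
Qed.

Lemma bonding_corner_edge : 3 <= n -> (n %% 4 == 1) || (n %% 4 == 2) ->
  bonding (G := mesh n 3) corner_edge.
Proof.
move=> n3 hn; apply/andP; split.
  by rewrite sub1set edge_in_edges // adj_vtx.
apply: leq_ltn_trans domination_number_mesh_le _.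
have [[D dom <-] _] := domination_numberP (mesh_gt0 corner_edge).
have h : 3 * n + 3 <= 4 * #|D| := corner_edge_card_ge n3 dom; lia.
Qed.

Lemma bonding_corner_edges : 3 <= n -> bonding (G := mesh n 3) corner_edges.
Proof.
move=> n3; apply/andP; split.
  by rewrite subUset !sub1set !edge_in_edges // ?adj_vtx //; lia.
apply: leq_ltn_trans domination_number_mesh_le _.
have [[D dom <-] _] := domination_numberP (mesh_gt0 corner_edges).
have h : 3 * n + 5 <= 4 * #|D| := corner_edges_card_ge n3 dom; lia.
Qed.

Lemma edges_mesh_neq0 : edges (mesh n 3) != set0.
Proof.
by apply/set0Pn; exists (edge 0 0 0 1); rewrite edge_in_edges // adj_vtx.
Qed.

End Mesh.

Theorem theorem4p1 (n : nat) (hn : 3 <= n) :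
  ((n = 1 %[mod 4] \/ n = 2 %[mod 4]) -> bondage_number (mesh n 3) = 1) /\
  ((n = 0 %[mod 4] \/ n = 3 %[mod 4]) -> bondage_number (mesh n 3) = 2).
Proof.
case: n hn => // n n3.
have [[B bondB <-] minB] := bondage_numberP (edges_mesh_neq0 n).
split=> hn; apply/eqP; rewrite eqn_leq; apply/andP; split.
- have hn' : (n.+1 %% 4 == 1) || (n.+1 %% 4 == 2) by lia.
  by have := minB _ (bonding_corner_edge n3 hn'); rewrite cards1.
- rewrite card_gt0; apply: contraL bondB => /eqP ->.
  by rewrite not_bonding ?cards0 ?eqxx.
- apply: leq_trans (minB _ (bonding_corner_edges n3)) _.
  by rewrite cards2; case: eqP.
rewrite ltnNge; apply: contraL bondB => B1.
by apply: not_bonding => //; lia.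
Qed.
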